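(* Let $S$ be a compact Hausdorff space without isolated points and let $T\colon C(S)\to C(S)$ be a bounded linear operator that factors through $c_0$, i.e. $T=T_2T_1$ for some bounded linear operators $T_1\colon C(S)\to c_0$ and $T_2\colon c_0\to C(S)$. Then $$\|\mathrm{Id}+T\| = 1+\|T\|.$$
   Context: Compact Hausdorff spaces are nonempty. Scalars are real: $C(S)$ is the real Banach space of continuous functions $S\to\mathbb{R}$ with the supremum norm, and $c_0$ is the Banach space of real null sequences with the supremum norm. $\mathrm{Id}$ is the identity operator and operators carry the operator norm. *)

(* Defs.v *)
From HB Require Import structures.
From mathcomp Require Import all_boot all_order all_algebra.
From mathcomp Require Import all_classical all_reals all_analysis.

Set Implicit Arguments.
Unset Strict Implicit.
Unset Printing Implicit Defensive.

Import Order.TTheory GRing.Theory Num.Theory.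
Import numFieldNormedType.Exports.

Local Open Scope classical_set_scope.
Local Open Scope ring_scope.

Section supnorm.
Context (R : realType) (X : Type).
Implicit Types f g : X -> R.

Definition supnorm f : R := sup [set `|f x| | x in [set: X]].

(* [bounded_fun f] of the library, in a form that does not need [X] to be
   inhabited. *)
Definition has_bound f := exists M : R, forall x, `|f x| <= M.

Lemma supnorm_le f (M : R) :
  0 <= M -> (forall x, `|f x| <= M) -> supnorm f <= M.
Proof.
move=> M0 fM; rewrite /supnorm.
have [->|X0] := eqVneq [set `|f x| | x in [set: X]] set0; first by rewrite sup0.
apply: ge_sup; first exact/set0P.
by move=> _ [x _ <-].
Qed.

Lemma le_supnorm f x : has_bound f -> `|f x| <= supnorm f.
Proof.
move=> [M fM]; apply: ub_le_sup; last by exists x.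
by exists M => _ [y _ <-]; exact: fM.
Qed.

Lemma supnorm_ge0 f : has_bound f -> 0 <= supnorm f.
Proof.
move=> bf; have [X0|] := eqVneq [set `|f x| | x in [set: X]] set0.
  by rewrite /supnorm X0 sup0.
by move=> /set0P[_ [x _ _]]; exact: le_trans (le_supnorm x bf).
Qed.

Lemma ler_supnormD f g : has_bound f -> has_bound g ->
  supnorm (f + g) <= supnorm f + supnorm g.
Proof.
move=> bf bg; apply: supnorm_le; first by rewrite addr_ge0 ?supnorm_ge0.
by move=> x; rewrite (le_trans (ler_normD _ _))// lerD ?le_supnorm.
Qed.

Lemma has_boundZ (a : R) f : has_bound f -> has_bound (a *: f).
Proof.
by move=> [M fM]; exists (`|a| * M) => x; rewrite normrM ler_wpM2l.
Qed.

Lemma supnormZ (a : R) f : has_bound f ->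
  supnorm (a *: f) = `|a| * supnorm f.
Proof.
move=> bf.
have le_supZ (b : R) g : has_bound g -> supnorm (b *: g) <= `|b| * supnorm g.
  move=> bg; apply: supnorm_le => [|x]; first by rewrite mulr_ge0 ?supnorm_ge0.
  by rewrite normrM ler_wpM2l ?le_supnorm.
apply/eqP; rewrite eq_le le_supZ//=.
have [->|a0] := eqVneq a 0.
  by rewrite normr0 mul0r; apply: supnorm_ge0; exact: has_boundZ.
rewrite -ler_pdivlMl ?normr_gt0// -normfV -[in leLHS](scale1r f) -(mulVf a0).
by rewrite -scalerA; apply: le_supZ; exact: has_boundZ.
Qed.

Lemma supnorm0_eq0 f : has_bound f -> supnorm f = 0 -> f = 0.
Proof.
move=> bf f0; apply/funext => x; apply/eqP.
by rewrite -normr_le0 -f0 le_supnorm.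
Qed.

End supnorm.

Section continuous_functions.
Context (R : realType) (S : topologicalType).

Definition cts : {pred S -> R} := mem [set f : S -> R | continuous f].

Lemma cts_submod_closed : submod_closed cts.
Proof.
split; first by rewrite inE => x; exact: cst_continuous.
move=> a f g; rewrite !inE => cf cg x.
by apply: cvgD (cg x); exact: cvgZ (cvg_cst a) (cf x).
Qed.

HB.instance Definition _ :=
  GRing.isSubmodClosed.Build R (S -> R) cts cts_submod_closed.

(* The space C(S) carries the compactness of [S], without which the supremum
   norm is not defined. It is not the library's [continuousType S R], whose
   canonical topology is not the norm topology. *)
Record contfun (cS : compact [set: S]) :=
  ContFun { contfun_val :> S -> R ; contfunP : contfun_val \in cts }.

Variable cS : compact [set: S].

HB.instance Definition _ := [isSub for @contfun_val cS].
HB.instance Definition _ := [Choice of contfun cS by <:].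
HB.instance Definition _ := [SubChoice_isSubLmodule of contfun cS by <:].

Lemma contfun_continuous (f : contfun cS) : continuous f.
Proof. exact: set_mem (contfunP f). Qed.

Lemma contfun_has_bound (f : contfun cS) : has_bound f.
Proof.
have /compact_bounded[M [_ fM]] : compact (range f).
  apply: continuous_compact => //.
  exact/continuous_subspaceT/contfun_continuous.
by exists (M + 1) => x; apply: fM; [by rewrite ltrDl|exists x].
Qed.

Let contfun_norm (f : contfun cS) := supnorm f.

Let ler_contfun_normD (f g : contfun cS) :
  contfun_norm (f + g) <= contfun_norm f + contfun_norm g.
Proof. by apply: ler_supnormD; exact: contfun_has_bound. Qed.

Let contfun_normZ (a : R) (f : contfun cS) :
  contfun_norm (a *: f) = `|a| * contfun_norm f.
Proof. by apply: supnormZ; exact: contfun_has_bound. Qed.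

Let contfun_norm0_eq0 (f : contfun cS) : contfun_norm f = 0 -> f = 0.
Proof.
by move=> /(supnorm0_eq0 (contfun_has_bound f)) f0; exact: val_inj.
Qed.

HB.instance Definition _ := @Lmodule_isNormed.Build R (contfun cS)
  contfun_norm ler_contfun_normD contfun_normZ contfun_norm0_eq0.

Lemma contfun_normE (f : contfun cS) : `|f| = supnorm f.
Proof. by []. Qed.

End continuous_functions.

Section null_sequences.
Context (R : realType).

Definition null_seq : {pred nat -> R} := mem [set u : R^nat | u @ \oo --> 0].

Lemma null_seq_submod_closed : submod_closed null_seq.
Proof.
split; first by rewrite inE; exact: cvg_cst.
move=> a u v; rewrite !inE /= => u0 v0.
have : (a *: (u : nat -> R) + v) @ \oo --> a *: (0 : R) + 0.
  by apply: cvgD v0; exact: cvgZ (cvg_cst a) u0.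
by rewrite scaler0 addr0.
Qed.

HB.instance Definition _ :=
  GRing.isSubmodClosed.Build R (nat -> R) null_seq null_seq_submod_closed.

Record c0 := C0 { c0_val :> nat -> R ; c0P : c0_val \in null_seq }.

HB.instance Definition _ := [isSub for c0_val].
HB.instance Definition _ := [Choice of c0 by <:].
HB.instance Definition _ := [SubChoice_isSubLmodule of c0 by <:].

Lemma c0_cvg (u : c0) : u n @[n --> \oo] --> 0.
Proof. exact: set_mem (c0P u). Qed.

Lemma c0_has_bound (u : c0) : has_bound u.
Proof.
have [M [_ uM]] : bounded_fun u.
  by apply: cvg_seq_bounded; apply/cvg_ex; exists 0; exact: c0_cvg.
by exists (M + 1) => n; apply: uM; first by rewrite ltrDl.
Qed.

Let c0_norm (u : c0) := supnorm u.

Let ler_c0_normD (u v : c0) : c0_norm (u + v) <= c0_norm u + c0_norm v.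
Proof. by apply: ler_supnormD; exact: c0_has_bound. Qed.

Let c0_normZ (a : R) (u : c0) : c0_norm (a *: u) = `|a| * c0_norm u.
Proof. by apply: supnormZ; exact: c0_has_bound. Qed.

Let c0_norm0_eq0 (u : c0) : c0_norm u = 0 -> u = 0.
Proof.
by move=> /(supnorm0_eq0 (c0_has_bound u)) u0; exact: val_inj.
Qed.

HB.instance Definition _ := @Lmodule_isNormed.Build R c0
  c0_norm ler_c0_normD c0_normZ c0_norm0_eq0.

Lemma c0_normE (u : c0) : `|u| = supnorm u.
Proof. by []. Qed.

End null_sequences.

(* Meaningful for bounded [T] only: [sup] of an unbounded set is 0. *)
Definition opnorm (R : realType) (V W : normedModType R) (T : {linear V -> W}) :
  R := sup [set `|T x| | x in [set x : V | `|x| <= 1]].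

Definition factors_through (R : realType) (E V W : normedModType R)
    (T : {linear V -> W}) :=
  exists (T1 : {linear V -> E}) (T2 : {linear E -> W}),
    [/\ bounded_fun_norm T1, bounded_fun_norm T2 & T =1 T2 \o T1].

(* Main.v *)
Require Import Defs.
From HB Require Import structures.
From mathcomp Require Import all_boot all_order all_algebra.
From mathcomp Require Import all_classical all_reals all_analysis.
From mathcomp Require Import lra.

Import Order.TTheory GRing.Theory Num.Theory.
Import numFieldNormedType.Exports.

Local Open Scope classical_set_scope.
Local Open Scope ring_scope.

(** Write [T = T2 \o T1] through c_0. The inequality [<=] is the triangle
    inequality. For [>=], it is enough to know that [T] is diffuse: every
    nonempty open [U] contains a nonempty open [W] such that [T f] is uniformly
    small on [W] whenever [f] has norm at most [2] and vanishes off [W]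
    ([factors_c0_small]). Indeed, take [f] in the unit ball such that [T f] is
    within [e] of [opnorm T] on a nonempty open set [U], choose [W] in [U], and
    deform [f] inside [W] alone into a function [h] of the unit ball equal to
    [1] at some point [s] of [W] ([peak_function]). Then [T h s] is close to
    [T f s], so [h s + T h s] is close to [1 + opnorm T].

    Diffuseness combines two independent facts.

    - A bounded functional on C(S) cannot charge every small open set. Split
      [U] into two disjoint nonempty open parts, which is possible since no
      point is isolated. The norms of the functional on the functions living in
      either part add up to at most its norm on those living in [U], so that
      one part carries at most half of it ([functional_halve]). Iterating
      makes finitely many functionals small on a common nonempty open set
      ([functionals_small]).

    - A bounded operator [T2] from c_0 to C(S) essentially sees only finitely
      many coordinates, uniformly on some nonempty open subset of [U]
      ([c0_tail_small]). This is a gliding-hump argument: let [m] be the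
      supremum of [T2 u s] over [u] in a ball and [s] in [U], and let [w], with
      finitely many nonzero terms, come within [e] of it at some point.
      It does so on a whole open set, and there any [v] of the ball supported
      where [w] vanishes satisfies [T2 w s + `|T2 v s| <= m], because [w + v]
      and [w - v] are still in the ball of the supremum norm.

    Applying the first fact to the finitely many coordinates of [T1] that
    matter by the second one yields [factors_c0_small]. Representing
    functionals by measures is thereby avoided: the halving lemma plays the
    role of a point which is an atom of none of the coordinate measures. *)

(** * The operator norm of a bounded operator *)

Section operator_norm.
Context {R : realType} {V W : normedModType R}.
Implicit Types T : {linear V -> W}.

Lemma has_sup_opnorm T : bounded_fun_norm T ->
  has_sup [set `|T x| | x in [set x : V | `|x| <= 1]].
Proof.
move=> /(_ 1)[M TM]; split; last by exists M => _ [x /= x1 <-]; exact: TM.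
by exists `|T 0|, 0 => //=; rewrite normr0.
Qed.

Lemma opnorm_ge0 T : bounded_fun_norm T -> 0 <= opnorm T.
Proof.
move=> /has_sup_opnorm [_ bT]; apply: le_trans (normr_ge0 (T 0)) _.
by apply: ub_le_sup => //; exists 0 => //=; rewrite normr0.
Qed.

Lemma le_opnorm T x : bounded_fun_norm T -> `|T x| <= opnorm T * `|x|.
Proof.
move=> bT; have [->|x0] := eqVneq x 0; first by rewrite linear0 !normr0 mulr0.
have nx0 : 0 < `|x| by rewrite normr_gt0.
rewrite -ler_pdivrMr// mulrC -[`|x|^-1]ger0_norm ?invr_ge0// -normrZ -linearZ.
apply: ub_le_sup; first by have [] := has_sup_opnorm T bT.
exists (`|x|^-1 *: x) => //=.
by rewrite normrZ ger0_norm ?invr_ge0// mulVf// gt_eqF.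
Qed.

Lemma opnorm_le T (M : R) :
  (forall x, `|x| <= 1 -> `|T x| <= M) -> opnorm T <= M.
Proof.
move=> TM; apply: ge_sup; first by exists `|T 0|, 0 => //=; rewrite normr0.
by move=> _ [x /= x1 <-]; exact: TM.
Qed.

Lemma opnorm_adherent T (e : R) : bounded_fun_norm T -> 0 < e ->
  exists2 x, `|x| <= 1 & opnorm T - e < `|T x|.
Proof.
move=> /has_sup_opnorm hT e0.
by have [_ [x /= x1 <-] xe] := sup_adherent e0 hT; exists x.
Qed.

End operator_norm.

(** * Coordinates and truncations of null sequences *)

Section null_sequences.
Context {R : realType}.
Implicit Types u v : c0 R.

(** Coordinates are named so that their composition with an operator into c_0
    is inferred to be an additive map. *)
Definition c0_coord n (u : c0 R) : R := u n.

Lemma c0_coord_is_additive n : zmod_morphism (c0_coord n).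
Proof. by []. Qed.

HB.instance Definition _ n :=
  GRing.isZmodMorphism.Build (c0 R) R (c0_coord n) (c0_coord_is_additive n).

Lemma le_c0_norm u n : `|u n| <= `|u|.
Proof. by apply: le_supnorm; exact: c0_has_bound. Qed.

Lemma c0_norm_le u (M : R) : 0 <= M -> (forall n, `|u n| <= M) -> `|u| <= M.
Proof. exact: supnorm_le. Qed.

Lemma c0_head_subproof N u :
  (fun n => if (n < N)%N then u n else 0) \in null_seq (R := R).
Proof.
rewrite inE /=; apply: cvg_near_cst.
by exists N => // n /= Nn; rewrite ltnNge Nn.
Qed.

Definition c0_head N u : c0 R := C0 (c0_head_subproof N u).

(** Controlling finitely many coordinates controls the norm of a truncation. *)
Lemma c0_head_norm_le N u (M : R) : 0 <= M ->
  (forall n, (n < N)%N -> `|u n| <= M) -> `|c0_head N u| <= M.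
Proof.
move=> M0 uM; apply: c0_norm_le => // n /=.
by case: ifPn => [/uM//|_]; rewrite normr0.
Qed.

Lemma c0_head_approx u (e : R) : 0 < e -> exists N, `|u - c0_head N u| <= e.
Proof.
move=> e0; have /cvgrPdist_le /(_ e e0)[N _ uN] := c0_cvg u.
exists N; apply: c0_norm_le; first exact: ltW.
move=> n; rewrite /= ; change (`|u n - (if (n < N)%N then u n else 0)| <= e).
case: ltnP => [_|Nn]; first by rewrite subrr normr0 ltW.
by have := uN n Nn; rewrite sub0r normrN subr0.
Qed.

End null_sequences.

(** * Functions supported in an open set *)

Section continuous_functions.
Context {R : realType} {S : topologicalType} {cS : compact [set: S]}.
Local Notation CS := (contfun R cS).

Definition contfun_of (f : S -> R) (cf : continuous f) : CS :=
  ContFun cS (mem_set cf).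

Lemma le_contfun_norm (f : CS) s : `|f s| <= `|f|.
Proof. by apply: le_supnorm; exact: contfun_has_bound. Qed.

Lemma contfun_norm_le (f : CS) (M : R) :
  0 <= M -> (forall s, `|f s| <= M) -> `|f| <= M.
Proof. exact: supnorm_le. Qed.

Lemma contfun_norm_lt (f : CS) (M : R) :
  [set: S] !=set0 -> M < `|f| -> exists s, M < `|f s|.
Proof.
move=> S0 Mf; apply: contrapT => /forallNP fM.
have fleM s : `|f s| <= M by rewrite leNgt; apply/negP/fM.
have [s _] := S0.
have M0 : 0 <= M by exact: le_trans (normr_ge0 _) (fleM s).
by have := contfun_norm_le f M M0 fleM; rewrite leNgt Mf.
Qed.

Lemma open_contfun_gt (f : CS) (a : R) : open [set s | a < f s].
Proof.
rewrite (_ : [set s | _] = f @^-1` [set x | a < x])//.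
apply: open_comp; last exact: open_gt.
by move=> s _; exact: contfun_continuous.
Qed.

Definition supp_ball (r : R) (W : set S) : set CS :=
  [set f : CS | `|f| <= r /\ forall s, ~ W s -> f s = 0].

Lemma supp_ballS r (W U : set S) : W `<=` U -> supp_ball r W `<=` supp_ball r U.
Proof. by move=> WU f [fr f0]; split => // s nUs; apply: f0 => /WU. Qed.

Lemma supp_ballN r (W : set S) (f : CS) :
  supp_ball r W f -> supp_ball r W (- f).
Proof.
move=> [fr f0]; split; first by rewrite normrN.
by move=> s /f0 fs; change (- f s = 0); rewrite fs oppr0.
Qed.

(** The supremum norm of functions with disjoint supports does not add up: this
    is what turns disjoint open sets into additivity of norms of functionals. *)
Lemma supp_ballD r (U V : set S) (f g : CS) : U `&` V = set0 ->
  supp_ball r U f -> supp_ball r V g -> supp_ball r (U `|` V) (f + g).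
Proof.
move=> UV0 [fr f0] [gr g0].
split; last first.
  move=> s nUV; change (f s + g s = 0).
  by rewrite f0 ?g0 ?addr0// => ?; apply: nUV; [right|left].
apply: contfun_norm_le; first exact: le_trans (normr_ge0 f) fr.
move=> s; change (`|f s + g s| <= r).
have [Us|nUs] := pselect (U s); last first.
  by rewrite f0// add0r (le_trans (le_contfun_norm g s)).
rewrite g0 ?addr0 ?(le_trans (le_contfun_norm f s))// => Vs.
by have : set0 s by rewrite -UV0.
Qed.

(** * Functionals are small on small open sets *)

Context (hS : hausdorff_space S) (isoS : isolated [set: S] = set0).

Lemma perfect_open_split (U : set S) : open U -> U !=set0 ->
  exists U1 U2 : set S, [/\ open U1 /\ U1 !=set0, open U2 /\ U2 !=set0,
    U1 `<=` U, U2 `<=` U & U1 `&` U2 = set0].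
Proof.
move=> oU [s Us].
have [t Ut ts] : exists2 t, U t & s != t.
  apply: contrapT => noT.
  have : isolated [set: S] s.
    split; first exact/mem_set.
    exists U; first exact: open_nbhs_nbhs.
    rewrite setIT; apply/seteqP; split => [t Ut|_ ->//].
    apply/eqP; rewrite eq_sym; apply: contrapT => /negP ts.
    by apply: noT; exists t.
  by rewrite isoS.
have := hS; rewrite open_hausdorff => /(_ s t ts)[[A B]] /=.
rewrite !inE => -[As Bt] [oA oB AB0].
exists (U `&` A), (U `&` B); split.
- by split; [exact: openI|exists s].
- by split; [exact: openI|exists t].
- exact: subIsetl.
- exact: subIsetl.
- by rewrite setIACA AB0 setI0.
Qed.

(** If both halves of [U] carried more than [c / 2], witnesses [f1] and [f2]
    would have [f1 + f2] and [f1 - f2] in the ball of [U], while the larger of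
    [`|phi (f1 + f2)|] and [`|phi (f1 - f2)|] is [`|phi f1| + `|phi f2|]. *)
Lemma functional_halve (phi : {additive CS -> R}) (r c : R) (U : set S) :
  open U -> U !=set0 -> (forall f, supp_ball r U f -> `|phi f| <= c) ->
  exists W : set S, [/\ open W, W !=set0, W `<=` U &
    forall f, supp_ball r W f -> `|phi f| <= c / 2].
Proof.
move=> oU U0 phic.
have [U1 [U2 [[oU1 U10] [oU2 U20] U1U U2U U120]]] := perfect_open_split U oU U0.
apply: contrapT => noW.
have large (V : set S) : open V -> V !=set0 -> V `<=` U ->
    exists2 f, supp_ball r V f & c / 2 < `|phi f|.
  move=> oV V0 VU; apply: contrapT => noF; apply: noW; exists V; split => //.
  by move=> f fV; rewrite leNgt; apply/negP => cf; apply: noF; exists f.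
have [f1 f1U c1] := large U1 oU1 U10 U1U.
have [f2 f2U c2] := large U2 oU2 U20 U2U.
have U12U : U1 `|` U2 `<=` U by rewrite subUset.
have := phic _ (supp_ballS r _ _ U12U _ (supp_ballD r _ _ _ _ U120 f1U f2U)).
have := phic _ (supp_ballS r _ _ U12U _
  (supp_ballD r _ _ _ _ U120 f1U (supp_ballN r _ _ f2U))).
rewrite raddfB raddfD /= !ler_norml => /andP[? ?] /andP[? ?].
move: c1 c2; rewrite !ltNge !ler_norml => /negP.
by rewrite !negb_and -!ltNge; lra.
Qed.

Lemma functional_small (phi : {additive CS -> R}) (r c e : R) (U : set S) :
  0 < e -> open U -> U !=set0 -> (forall f, supp_ball r U f -> `|phi f| <= c) ->
  exists W : set S, [/\ open W, W !=set0, W `<=` U &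
    forall f, supp_ball r W f -> `|phi f| <= e].
Proof.
move=> e0 oU U0 phic.
have shrink k : exists W : set S, [/\ open W, W !=set0, W `<=` U &
    forall f, supp_ball r W f -> `|phi f| <= c / 2 ^+ k].
  elim: k => [|k [W [oW W0 WU Wc]]].
    by exists U; split => // f; rewrite expr0 divr1; exact: phic.
  have [W' [oW' W'0 W'W W'c]] := functional_halve phi r _ W oW W0 Wc.
  exists W'; split => //; first exact: subset_trans WU.
  by move=> f /W'c; rewrite exprSr invfM mulrA.
(* [c / e < k <= 2 ^ k] for this [k]. *)
have [W [oW W0 WU Wc]] := shrink (Num.truncn (c / e)).+1.
exists W; split => // f /Wc /le_trans; apply.
rewrite ler_pdivrMr ?exprn_gt0// mulrC -ler_pdivrMr//.
apply: ltW; apply: lt_le_trans (truncnS_gt _) _.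
by rewrite -natrX ler_nat ltnW// ltn_expl.
Qed.

(** Smallness passes to smaller open sets, so the functionals can be treated one
    after the other. *)
Lemma functionals_small (phi : nat -> {additive CS -> R}) (r c e : R)
    (U : set S) (N : nat) : 0 < e -> open U -> U !=set0 ->
  (forall n f, supp_ball r U f -> `|phi n f| <= c) ->
  exists W : set S, [/\ open W, W !=set0, W `<=` U &
    forall n f, (n < N)%N -> supp_ball r W f -> `|phi n f| <= e].
Proof.
move=> e0 oU U0 phic; elim: N => [|N [W [oW W0 WU We]]].
  by exists U; split.
have phiWc f : supp_ball r W f -> `|phi N f| <= c.
  by move=> /(supp_ballS r _ _ WU); exact: phic.
have [W' [oW' W'0 W'W W'e]] := functional_small (phi N) r c e W e0 oW W0 phiWc.
exists W'; split => //; first exact: subset_trans WU.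
move=> n f; rewrite ltnS leq_eqVlt => /predU1P[->|nN fW']; first exact: W'e.
by apply: We => //; exact: supp_ballS W'W _ fW'.
Qed.

(** * Operators that factor through c_0 *)

(** Near a point where [T] almost attains its supremum over the ball at a
    sequence [w] of finite support, nothing of the supremum is left for the
    sequences whose support is disjoint from that of [w]. *)
Lemma c0_tail_small (T : {linear c0 R -> CS}) (r e : R) (U : set S) :
  bounded_fun_norm T -> 0 <= r -> 0 < e -> open U -> U !=set0 ->
  exists N (W : set S), [/\ open W, W !=set0, W `<=` U &
    forall (v : c0 R) s, (forall n, (n < N)%N -> v n = 0) -> `|v| <= r -> W s ->
      `|T v s| <= e].
Proof.
move=> bT r0 e0 oU [s0 Us0].
pose E := [set T p.1 p.2 | p in [set p : c0 R * S | `|p.1| <= r /\ U p.2]].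
have T0 : 0 <= opnorm T := opnorm_ge0 T bT.
have Tle (u : c0 R) s : `|T u s| <= opnorm T * `|u|.
  exact: le_trans (le_contfun_norm _ _) (le_opnorm T u bT).
have supE : has_sup E.
  split; first by exists (T 0 s0), (0, s0) => //=; rewrite normr0.
  exists (opnorm T * r) => _ [[u s] /= [ur Us] <-].
  by rewrite (le_trans (ler_norm _))// (le_trans (Tle _ _))// ler_wpM2l.
have e20 : 0 < e / 2 by rewrite divr_gt0.
have [_ [[u s] /= [ur Us] <-] Tu] := sup_adherent e20 supE.
(* [opnorm T + 1] stands for [opnorm T], which may be zero. *)
have d0 : 0 < e / 2 / (opnorm T + 1) by rewrite divr_gt0// ltr_wpDl.
have [N uN] := c0_head_approx u _ d0.
pose w := c0_head N u.
have wr : `|w| <= r.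
  by apply: c0_head_norm_le => // n _; exact: le_trans (le_c0_norm u n) ur.
have Tw : sup E - e < T w s.
  have : `|T u s - T w s| <= e / 2.
    have -> : T u s - T w s = T (u - w) s by rewrite linearB.
    apply: le_trans (Tle _ _) _.
    apply: le_trans (_ : (opnorm T + 1) * `|u - w| <= _).
      by rewrite ler_wpM2r// lerDl.
    by rewrite mulrC -ler_pdivlMr// ltr_wpDl.
  by rewrite ler_norml => /andP[_]; lra.
exists N, (U `&` [set t | sup E - e < T w t]); split.
- by apply: openI => //; exact: open_contfun_gt.
- by exists s.
- exact: subIsetl.
move=> v t v0 vr [Ut /= Twt].
have Tle_sup (z : c0 R) : (forall n, `|z n| <= r) -> T z t <= sup E.
  move=> zr; apply: ub_le_sup; first by have [] := supE.
  by exists (z, t) => //=; split => //; exact: c0_norm_le.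
have vr' n : `|v n| <= r by exact: le_trans (le_c0_norm v n) vr.
have ur' n : `|u n| <= r by exact: le_trans (le_c0_norm u n) ur.
have TD : T w t + T v t <= sup E.
  have <- : T (w + v) t = T w t + T v t by rewrite linearD.
  apply: Tle_sup => n.
  change (`|(if (n < N)%N then u n else 0) + v n| <= r).
  by case: ltnP => [/v0 ->|_]; rewrite ?addr0 ?add0r.
have TB : T w t - T v t <= sup E.
  have <- : T (w - v) t = T w t - T v t by rewrite linearB.
  apply: Tle_sup => n.
  change (`|(if (n < N)%N then u n else 0) - v n| <= r).
  by case: ltnP => [/v0 ->|_]; rewrite ?subr0 ?sub0r ?normrN.
by rewrite ler_norml; apply/andP; split; lra.
Qed.

(** The open set is shrunk twice: first to make the tail of [T1 f] harmless for
    [T2], which fixes a number [N] of coordinates, then to make these [N]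
    coordinates of [T1 f] small. *)
Lemma factors_c0_small (T : {linear CS -> CS}) (r e : R) (U : set S) :
  factors_through (c0 R) T -> 0 < e -> open U -> U !=set0 ->
  exists W : set S, [/\ open W, W !=set0, W `<=` U &
    forall f s, supp_ball r W f -> W s -> `|T f s| <= e].
Proof.
move=> [T1 [T2 [bT1 bT2 TE]]] e0 oU U0.
have [M T1M] := bT1 r.
(* If [M < 0], there is no [f] to consider. *)
have [M0|M0] := leP 0 M; last first.
  exists U; split => // f s [/T1M fM _] _.
  by have := le_trans (normr_ge0 _) fM; rewrite leNgt M0.
have e20 : 0 < e / 2 by rewrite divr_gt0.
have [N [V [oV V0 VU Ve]]] := c0_tail_small T2 M (e / 2) U bT2 M0 e20 oU U0.
pose phi n : {additive CS -> R} := c0_coord n \o T1.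
have T20 := opnorm_ge0 T2 bT2.
have d0 : 0 < e / 2 / (opnorm T2 + 1) by rewrite divr_gt0// ltr_wpDl.
have phiM n f : supp_ball r V f -> `|phi n f| <= M.
  by move=> [/T1M fM _]; exact: le_trans (le_c0_norm _ _) fM.
have [W [oW W0 WV We]] := functionals_small phi r M _ V N d0 oV V0 phiM.
exists W; split => //; first exact: subset_trans VU.
move=> f s fW Ws; have [fr _] := fW; rewrite TE /=.
pose u := T1 f; pose h := c0_head N u; rewrite -/u.
have -> : T2 u s = T2 h s + T2 (u - h) s.
  change (T2 u s = (T2 h + T2 (u - h)) s).
  by rewrite -linearD addrC subrK.
have h_small : `|T2 h s| <= e / 2.
  apply: le_trans (le_contfun_norm _ _) _.
  apply: le_trans (le_opnorm T2 h bT2) _.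
  apply: le_trans (_ : (opnorm T2 + 1) * `|h| <= _).
    by rewrite ler_wpM2r// lerDl.
  rewrite mulrC -ler_pdivlMr ?ltr_wpDl//.
  apply: c0_head_norm_le; first exact: ltW.
  by move=> n nN; exact: We n f nN fW.
have tail_small : `|T2 (u - h) s| <= e / 2.
  apply: Ve; last exact: WV.
    move=> n nN; change (u n - (if (n < N)%N then u n else 0) = 0).
    by rewrite nN subrr.
  apply: c0_norm_le => // n.
  change (`|u n - (if (n < N)%N then u n else 0)| <= M).
  case: ltnP => _; first by rewrite subrr normr0.
  by rewrite subr0; exact: le_trans (le_c0_norm u n) (T1M f fr).
rewrite (le_trans (ler_normD _ _))//; lra.
Qed.

(** * Raising a function to 1 at a point *)

Lemma bump_function (W : set S) s : open W -> W s ->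
  exists chi : CS, [/\ forall t, 0 <= chi t <= 1, chi s = 1 &
    forall t, ~ W t -> chi t = 0].
Proof.
move=> oW Ws.
have cls : closed [set s].
  exact/accessible_closed_set1/hausdorff_accessible.
have disj : ~` W `&` [set s] = set0.
  by apply/seteqP; split => // t [nWt ts]; apply: nWt; rewrite ts.
have [chi [cchi chi0 chi1 chi01]] := @urysohn_ext_itv S R
  (compact_normal hS cS) _ _ 0 1 (open_closedC oW) cls disj ltr01.
exists (contfun_of chi cchi); split => /=.
- by move=> t; have := chi01 (chi t); rewrite /= in_itv; apply; exists t.
- by apply: chi1; exists s.
- by move=> t nWt; apply: chi0; exists t.
Qed.

(** With a bump [chi] in [W], the function [h = f + chi * (1 - f)] is at each
    point a convex combination of [f] and [1], so it stays in the unit ball. *)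
Lemma peak_function (f : CS) (W : set S) s : `|f| <= 1 -> open W -> W s ->
  exists h : CS, [/\ `|h| <= 1, h s = 1 & supp_ball 2 W (h - f)].
Proof.
move=> f1 oW Ws; have [chi [chi01 chis chi0]] := bump_function W s oW Ws.
have cg : continuous (fun t => chi t * (1 - f t)).
  move=> t; apply: cvgM; first exact: contfun_continuous.
  by apply: cvgB; [exact: cvg_cst|exact: contfun_continuous].
pose g : CS := contfun_of _ cg.
have fle1 t : -1 <= f t <= 1.
  by rewrite -ler_norml (le_trans (le_contfun_norm f t)).
exists (f + g); split.
- apply: contfun_norm_le => // t.
  change (`|f t + chi t * (1 - f t)| <= 1).
  by have /andP[? ?] := chi01 t; have /andP[? ?] := fle1 t;
    rewrite ler_norml; apply/andP; split; nra.
- by change (f s + chi s * (1 - f s) = 1); rewrite chis mul1r addrC subrK.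
rewrite addrAC subrr add0r; split; last first.
  by move=> t /chi0 chit /=; rewrite chit mul0r.
apply: contfun_norm_le => // t /=.
by have /andP[? ?] := chi01 t; have /andP[? ?] := fle1 t;
  rewrite ler_norml; apply/andP; split; nra.
Qed.

End continuous_functions.

(** * The Daugavet equation *)

Theorem theorem7 (R : realType) (S : topologicalType)
    (cS : compact [set: S]) (hS : hausdorff_space S) (S0 : [set: S] !=set0)
    (isoS : isolated [set: S] = set0)
    (T : {linear contfun R cS -> contfun R cS})
    (bT : bounded_fun_norm T)
    (fT : factors_through (c0 R) T) :
  opnorm (idfun \+ T) = 1 + opnorm T.
Proof.
have bIT : bounded_fun_norm (idfun \+ T).
  move=> r; have [M TM] := bT r; exists (r + M) => f fr /=.
  by rewrite (le_trans (ler_normD _ _))// lerD// TM.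
apply/eqP; rewrite eq_le; apply/andP; split.
  apply: opnorm_le => f f1 /=.
  rewrite (le_trans (ler_normD _ _))// lerD//.
  by rewrite (le_trans (le_opnorm T f bT))// ler_piMr// opnorm_ge0.
apply/ler_addgt0Pr => e e0; have e20 : 0 < e / 2 by rewrite divr_gt0.
(* Replacing [f] by [- f] removes the absolute value. *)
have [f f1 fs] : exists2 f : contfun R cS, `|f| <= 1 &
    exists s, opnorm T - e / 2 < T f s.
  have [f f1 Tf] := opnorm_adherent T _ bT e20.
  have [s Tfs] := contfun_norm_lt _ _ S0 Tf.
  have [Tfs0|Tfs0] := leP 0 (T f s).
    by exists f => //; exists s; rewrite ger0_norm in Tfs.
  exists (- f); first by rewrite normrN.
  exists s; rewrite linearN; change (opnorm T - e / 2 < - T f s).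
  by rewrite ltr0_norm in Tfs.
have [W [oW [s Ws] WU We]] := factors_c0_small hS isoS T 2 (e / 2) _ fT e20
  (open_contfun_gt (T f) (opnorm T - e / 2)) fs.
have [h [h1 hs hfW]] := peak_function hS f W s f1 oW Ws.
have Tf := WU s Ws; rewrite /= in Tf.
have := We _ s hfW Ws.
have -> : T (h - f) s = T h s - T f s by rewrite linearB.
rewrite ler_norml => /andP[Thf _].
have : h s + T h s <= opnorm (idfun \+ T).
  change ((idfun \+ T) h s <= opnorm (idfun \+ T)).
  rewrite (le_trans (ler_norm _))// (le_trans (le_contfun_norm _ _))//.
  rewrite (le_trans (le_opnorm _ h bIT))// ler_piMr// opnorm_ge0//.
by rewrite hs; lra.
Qed.
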